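(* Let $n\ge 3$ and let $F_n^1$ be the complex $n$-dimensional Leibniz algebra with basis $\{x_1,\dots,x_n\}$ and multiplication $[x_i,x_1]=x_{i+1}$ for $2\le i\le n-1$ (all other products of basis elements are zero). Let $V\subset ZL^2(F_n^1,F_n^1)$ be the linear span of the cocycles $\xi_1,\xi_2,\varphi_{1,2},\psi_2$, $\varphi_{n,k}$ ($2\le k\le n$) and $\psi_k$ ($4\le k\le n$) (a space of representatives of $HL^2(F_n^1,F_n^1)$). Then, up to isomorphism, the Leibniz algebras $F_n^1+\varphi$ obtained from the linear integrable deformations $\varphi\in V$ are exactly the following algebras (all products of basis elements not listed are zero): (i) the algebras of the family $F_1$ (with parameters $\theta,\alpha_4,\dots,\alpha_n\in\mathbb{C}$): $$[x_i,x_1]=x_{i+1}\ (2\le i\le n-1),\quad [x_1,x_2]=\theta x_n,\quad [x_j,x_2]=\alpha_4x_{j+2}+\alpha_5x_{j+3}+\dots+\alpha_{n+2-j}x_n\ (2\le j\le n-2);$$ (ii) the algebras $\lambda(a_1,\dots,a_n)$, $a_1,\dots,a_n\in\mathbb{C}$: $$[x_1,x_1]=a_1x_2,\quad [x_i,x_1]=x_{i+1}\ (2\le i\le n-1),\quad [x_n,x_1]=\sum_{k=2}^n a_kx_k;$$ (iii) the algebra $R$: $$[x_i,x_1]=x_{i+1}\ (2\le i\le n-1),\quad [x_1,x_2]=x_1,\quad [x_i,x_2]=(i-2)x_i\ (3\le i\le n),\quad [x_i,x_3]=-x_{i+1}\ (2\le i\le n-1).$$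
   Context: A Leibniz algebra over $\mathbb{C}$ is a vector space $L$ with a bilinear bracket satisfying $[x,[y,z]]=[[x,y],z]-[[x,z],y]$. $ZL^2(L,L)$ is the space of $2$-cocycles: bilinear maps $\varphi:L\times L\to L$ with $[x,\varphi(y,z)]-[\varphi(x,y),z]+[\varphi(x,z),y]+\varphi(x,[y,z])-\varphi([x,y],z)+\varphi([x,z],y)=0$ for all $x,y,z$; $HL^2(L,L)$ is its quotient by the coboundaries $f(x,y)=[d(x),y]+[x,d(y)]-d([x,y])$, $d:L\to L$ linear. A $2$-cocycle $\varphi$ is a linear integrable deformation if $\varphi(x,\varphi(y,z))-\varphi(\varphi(x,y),z)+\varphi(\varphi(x,z),y)=0$ for all $x,y,z$; equivalently, for a cocycle $\varphi$, the bracket $[-,-]+t\varphi$ is a Leibniz bracket for all $t$ (equivalently for $t=1$). $F_n^1+\varphi$ denotes the vector space of $F_n^1$ with bracket $[x,y]+\varphi(x,y)$. The cocycles of $F_n^1$ used here are the bilinear maps with the following nonzero values on pairs of basis elements (all values not listed are zero): $\varphi_{j,k}(x_j,x_1)=x_k$ for $1\le j\le n$, $2\le k\le n$; for $2\le j\le n$, $\psi_j(x_i,x_2)=x_{j+i-2}$ for $2\le i\le n-j+2$; $\xi_1(x_1,x_2)=x_1$, $\xi_1(x_i,x_2)=(i-2)x_i$ for $3\le i\le n$, $\xi_1(x_i,x_3)=-x_{i+1}$ for $2\le i\le n-1$; $\xi_2(x_1,x_2)=x_n$. *)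

(* Defs.v *)
From HB Require Import structures.
From mathcomp Require Import all_boot all_order all_algebra.
From mathcomp Require Import reals complex.

Set Implicit Arguments.
Unset Strict Implicit.
Unset Printing Implicit Defensive.

Import GRing.Theory.
Local Open Scope ring_scope.

Section Leibniz.
Variable K : fieldType.

(* A curried linear map: bilinear by construction, and itself a vector of a
   finite-dimensional space, so sums and spans of bilinear maps are the
   library ones. *)
Definition bilin (L : vectType K) := 'Hom(L, 'Hom(L, L)).

Definition leibniz (L : vectType K) (mu : bilin L) : Prop :=
  forall x y z : L, mu x (mu y z) = mu (mu x y) z - mu (mu x z) y.

Definition cocycle2 (L : vectType K) (mu phi : bilin L) : Prop :=
  forall x y z : L,
    mu x (phi y z) - mu (phi x y) z + mu (phi x z) y
    + phi x (mu y z) - phi (mu x y) z + phi (mu x z) y = 0.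

Definition linear_integrable (L : vectType K) (mu phi : bilin L) : Prop :=
  cocycle2 mu phi /\
  forall x y z : L,
    phi x (phi y z) - phi (phi x y) z + phi (phi x z) y = 0.

Definition isomorphic (L L' : vectType K) (mu : bilin L) (nu : bilin L') :
    Prop :=
  exists2 f : 'Hom(L, L'), bijective f &
    forall x y : L, f (mu x y) = nu (f x) (f y).

End Leibniz.

Section Algebras.
Variables (K : fieldType) (n : nat).
Local Notation L := 'rV[K]_n.

(* x_i, numbered from 1; it is 0 when i is not in [1, n]. *)
Definition x_ (i : nat) : L := \row_(j < n) (j.+1 == i)%:R.

(* The bilinear map with value c i j on (x_i, x_j), for 1 <= i, j <= n. *)
Definition of_table (c : nat -> nat -> L) : bilin L :=
  linfun (fun u : L => linfun (fun v : L =>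
    \sum_(i < n) \sum_(j < n) (u 0 i * v 0 j) *: c i.+1 j.+1)).

Lemma of_tableE_gen (c : nat -> nat -> L) (u v : L) :
  of_table c u v =
  \sum_(i < n) \sum_(j < n) (u 0 i * v 0 j) *: c i.+1 j.+1.
Proof.
pose g (u v : L) : L :=
  \sum_(i < n) \sum_(j < n) (u 0 i * v 0 j) *: c i.+1 j.+1.
have lin_r w : linear (g w).
  move=> a s t; rewrite /g scaler_sumr -big_split; apply: eq_bigr => i _.
  rewrite scaler_sumr -big_split; apply: eq_bigr => j _ /=.
  by rewrite !mxE mulrDr scalerDl scalerA mulrCA.
pose gr w := GRing.isLinear.Build K L L *:%R (g w) (lin_r w).
have gE w t : linfun (g w) t = g w t.
  pose G : {linear L -> L} := HB.pack (g w) (gr w).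
  exact: (lfunE G).
have lin_l : linear (fun w : L => linfun (g w)).
  move=> a s t; apply/lfunP => w; rewrite add_lfunE scale_lfunE !gE.
  rewrite /g scaler_sumr -big_split; apply: eq_bigr => i _.
  rewrite scaler_sumr -big_split; apply: eq_bigr => j _ /=.
  by rewrite !mxE mulrDl scalerDl scalerA mulrA.
pose gl := GRing.isLinear.Build K L 'Hom(L, L) *:%R
  (fun w : L => linfun (g w)) lin_l.
pose H : {linear L -> 'Hom(L, L)} := HB.pack (fun w : L => linfun (g w)) gl.
by rewrite /of_table (lfunE H) /= gE.
Qed.

Lemma of_tableE (c : nat -> nat -> L) (i j : nat) :
  (1 <= i <= n)%N -> (1 <= j <= n)%N -> of_table c (x_ i) (x_ j) = c i j.
Proof.
case: i => // i /= lt_in; case: j => // j /= lt_jn; rewrite of_tableE_gen.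
rewrite (bigD1 (Ordinal lt_in)) //= (bigD1 (Ordinal lt_jn)) //= !mxE !eqxx.
rewrite mulr1 scale1r !big1 ?addr0 // => [k|k] neq_k.
  rewrite big1 // => l _; rewrite !mxE eqSS.
  have /negbTE-> : k != i :> nat := neq_k.
  by rewrite mul0r scale0r.
rewrite !mxE !eqSS; have /negbTE-> : k != j :> nat := neq_k.
by rewrite mulr0 scale0r.
Qed.

Definition F_n1 : bilin L := of_table (fun i j =>
  if (j == 1)%N && (2 <= i <= n - 1)%N then x_ i.+1 else 0).

Definition phi_ (j k : nat) : bilin L := of_table (fun i l =>
  if (i == j) && (l == 1)%N then x_ k else 0).

Definition psi_ (j : nat) : bilin L := of_table (fun i l =>
  if (l == 2)%N && (2 <= i <= n - j + 2)%N then x_ (j + i - 2) else 0).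

Definition xi1 : bilin L := of_table (fun i j =>
  if (i == 1)%N && (j == 2)%N then x_ 1
  else if (3 <= i <= n)%N && (j == 2)%N then (i - 2)%:R *: x_ i
  else if (2 <= i <= n - 1)%N && (j == 3)%N then - x_ i.+1
  else 0).

Definition xi2 : bilin L := of_table (fun i j =>
  if (i == 1)%N && (j == 2)%N then x_ n else 0).

Definition V_reps : {vspace bilin L} :=
  <<[:: xi1; xi2; phi_ 1 2; psi_ 2]
    ++ [seq phi_ n k | k <- index_iota 2 n.+1]
    ++ [seq psi_ k | k <- index_iota 4 n.+1]>>%VS.

(* Only the values alpha k for 4 <= k <= n are used. *)
Definition alg_F1 (theta : K) (alpha : nat -> K) : bilin L :=
  of_table (fun i j =>
    if (2 <= i <= n - 1)%N && (j == 1)%N then x_ i.+1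
    else if (i == 1)%N && (j == 2)%N then theta *: x_ n
    else if (2 <= i <= n - 2)%N && (j == 2)%N then
      \sum_(4 <= k < (n + 2 - i).+1) alpha k *: x_ (i + k - 2)
    else 0).

(* Only the values a k for 1 <= k <= n are used. *)
Definition alg_lambda (a : nat -> K) : bilin L :=
  of_table (fun i j =>
    if (i == 1)%N && (j == 1)%N then a 1%N *: x_ 2
    else if (2 <= i <= n - 1)%N && (j == 1)%N then x_ i.+1
    else if (i == n) && (j == 1)%N then \sum_(2 <= k < n.+1) a k *: x_ k
    else 0).

Definition alg_R : bilin L :=
  of_table (fun i j =>
    if (2 <= i <= n - 1)%N && (j == 1)%N then x_ i.+1
    else if (i == 1)%N && (j == 2)%N then x_ 1
    else if (3 <= i <= n)%N && (j == 2)%N then (i - 2)%:R *: x_ i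
    else if (2 <= i <= n - 1)%N && (j == 3)%N then - x_ i.+1
    else 0).

Definition listed (mu : bilin L) : Prop :=
  [\/ exists (theta : K) (alpha : nat -> K), mu = alg_F1 theta alpha,
      exists a : nat -> K, mu = alg_lambda a
    | mu = alg_R].

End Algebras.

Arguments F_n1 : clear implicits.
Arguments V_reps : clear implicits.

(* Main.v *)
Require Import Defs.
From HB Require Import structures.
From mathcomp Require Import all_boot all_order all_algebra.
From mathcomp Require Import reals complex.
From mathcomp Require Import ring zify.

(** Every bracket in the statement is determined by three right
    multiplications: for j > 3 right multiplication by x_j is 0, so the
    bracket of u and v is u (v_1 P + v_2 Q + v_3 S) for square matrices
    P, Q, S acting on row vectors (bracket3).  For F_n^1 one has
    P = N, the shift x_i -> x_(i+1) for i >= 2, and Q = S = 0.  A general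
    element of the span V has

      P = c E_(1,2) + sum_k e_k E_(n,k),    S = - a N,
      Q = a D + b E_(1,n) + d N^0 + sum_k f_k N^(k-2),

    with N^0 the projection onto the span of x_2, ..., x_n along x_1, and
    D = diag(1, 0, 1, 2, ..., n - 2), which grades the shift in the sense
    that N D = D N + N.  This identity makes every element of V a
    cocycle (V_cocycle).

    Evaluating the quadratic integrability condition on (x_1, x_1), (x_2, x_2),
    (x_2, x_1) and (x_1, x_2) gives c Q = 0, d = 0, P Q = Q P, and, when a is
    nonzero, P = 0 together with b = 0 if n = 3.  When a = 0 the commutation
    of P and Q forces one of them to vanish.  There remain three cases.

    - a = 0, Q = 0: the deformed bracket is equal to some lambda(a_1, ..., a_n).
    - a = 0, P = 0: the deformed bracket is equal to a member of F_1.
    - a <> 0, P = 0: the deformed algebra is isomorphic to R (iso_alg_R).  Right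
      multiplication by x_2 has the eigenvalues a, 0, a, 2 a, ..., (n - 2) a,
      and the isomorphism diagonalises it: x_1 is corrected by a multiple of x_n,
      and on the span of x_2, ..., x_n one multiplies by q(N), where the
      polynomial q with constant term a solves the differential equation
      a X q' = f q modulo X^n, with f = sum_k f_k X^(k-2)
      (exists_ode_poly).  Characteristic 0 is used to solve it degree by
      degree.

    Conversely the three families are visibly of this form
    (listed_deformations). *)

Set Implicit Arguments.
Unset Strict Implicit.
Unset Printing Implicit Defensive.

Import GRing.Theory VectorInternalTheory.
Local Open Scope ring_scope.

(** * Deformed brackets and spans *)

(** The defect of the Leibniz identity for mu + phi is the sum of the defect
    for mu, the cocycle expression of phi and the defect for phi. *)
Lemma leibnizD (K : fieldType) (V : vectType K) (mu phi : bilin V) :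
  leibniz mu -> linear_integrable mu phi -> leibniz (mu + phi).
Proof.
move=> mu_leib [phi_coc phi_int] x y z.
rewrite !add_lfunE !linearD /= !add_lfunE.
have := phi_coc x y z; have := phi_int x y z; rewrite mu_leib.
move: (mu (mu x y) z) (mu (mu x z) y) (phi x (phi y z)) (phi (phi x y) z).
move: (phi (phi x z) y) (mu x (phi y z)) (mu (phi x y) z) (mu (phi x z) y).
move: (phi x (mu y z)) (phi (mu x y) z) (phi (mu x z) y).
move=> a1 a2 a3 a4 a5 a6 a7 a8 a9 a10 a11 int0 coc0; apply/eqP.
rewrite -subr_eq0 -(addr0 0) -{1}int0 -coc0; apply/eqP.
apply: (can_inj v2rK); rewrite !(linearD, linearN) /=.
by apply/rowP=> i; rewrite !mxE; ring.
Qed.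

Lemma iso_refl (K : fieldType) (V : vectType K) (mu : bilin V) :
  isomorphic mu mu.
Proof.
exists \1%VF => [|x y]; last by rewrite !id_lfunE.
by exists id => x; rewrite id_lfunE.
Qed.

(** For a repetition-free index list the coefficients can be read as a
    function of the index. *)
Lemma span_mapP (K : fieldType) (V : vectType K) (F : nat -> V) (r : seq nat)
    (v : V) :
  uniq r -> (v \in <<[seq F k | k <- r]>>%VS) <->
    (exists e : nat -> K, v = \sum_(k <- r) e k *: F k).
Proof.
move=> uniq_r; split=> [|[e ->]]; last first.
  rewrite big_seq; apply: memv_suml => k r_k; apply/memvZ/memv_span.
  exact: map_f.
elim: r uniq_r v => [_ v|k r IHr /= /andP[r'k uniq_r] v].
  by rewrite span_nil memv0 => /eqP->; exists (fun=> 0); rewrite big_nil.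
rewrite span_cons => /memv_addP[_ /vlineP[c ->] [w /IHr-/(_ uniq_r)[e ->] ->]].
exists (fun j => if j == k then c else e j); rewrite big_cons eqxx.
congr (_ + _); apply: eq_big_seq => j r_j; case: eqP => // eq_jk.
by rewrite -eq_jk r_j in r'k.
Qed.

(** * Brackets determined by three right multiplications *)

Section Basis.
Variables (K : fieldType) (n : nat).
Local Notation L := 'rV[K]_n.
Local Notation x_ := (@x_ K n).

(** Given by a sum, rather than by evaluation at an ordinal, so that it is a
    total function of the index i, like x_i itself. *)
Definition crd (i : nat) (v : L) : K := \sum_(j < n) v 0 j * (j.+1 == i)%:R.

Lemma crd_is_linear i : linear_for *%R (crd i).
Proof.
move=> a u v; rewrite /crd mulr_sumr -big_split; apply: eq_bigr => j _ /=.
by rewrite !mxE mulrDl mulrA.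
Qed.
HB.instance Definition _ i :=
  GRing.isLinear.Build K L K *%R (crd i) (crd_is_linear i).

Lemma crdD i u v : crd i (u + v) = crd i u + crd i v.
Proof. exact: linearD. Qed.

Lemma crdZ i a u : crd i (a *: u) = a * crd i u.
Proof. exact: linearZ. Qed.

Lemma crdN i u : crd i (- u) = - crd i u.
Proof. exact: linearN. Qed.

Lemma x_out i : ~~ (1 <= i <= n)%N -> x_ i = 0.
Proof.
move=> out_i; apply/rowP=> j; rewrite !mxE; case: eqP => // def_i.
by rewrite -def_i /= ltn_ord in out_i.
Qed.

Lemma crd_x i j : crd i (x_ j) = ((i == j) && (1 <= i <= n)%N)%:R.
Proof.
rewrite /crd; have [in_i | out_i] := boolP (1 <= i <= n)%N; last first.
  rewrite andbF big1 // => k _; case: eqP => [def_i|]; last by rewrite mulr0.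
  by rewrite -def_i /= ltn_ord in out_i.
case: i in_i => // i lt_in; rewrite (bigD1 (Ordinal lt_in)) //= !mxE eqxx mulr1.
rewrite big1 ?addr0 ?andbT // => k neq_k; rewrite eqSS.
by have /negbTE-> : k != i :> nat := neq_k; rewrite mulr0.
Qed.

Lemma x_expansion (u : L) : u = \sum_(i < n) u 0 i *: x_ i.+1.
Proof.
apply/rowP=> j; rewrite summxE (bigD1 j) //= !mxE eqxx mulr1.
rewrite big1 ?addr0 // => k neq_k; rewrite !mxE eqSS.
by have /negbTE-> : j != k :> nat; rewrite ?mulr0 // eq_sym; exact: neq_k.
Qed.

Lemma mx_basis_eq (A B : 'M[K]_n) :
  (forall i, (1 <= i <= n)%N -> x_ i *m A = x_ i *m B) -> A = B.
Proof.
move=> eqAB; apply/row_matrixP=> i; rewrite !rowE.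
have <- : x_ i.+1 = delta_mx 0 i by apply/rowP=> j; rewrite !mxE eqSS.
by apply: eqAB; rewrite /= ltn_ord.
Qed.

Lemma crd_mulmx (i k : nat) (c : K) (A : 'M[K]_n) :
  (forall j, (1 <= j <= n)%N -> crd i (x_ j *m A) = c * crd k (x_ j)) ->
  forall u : L, crd i (u *m A) = c * crd k u.
Proof.
move=> basis u; rewrite [u]x_expansion mulmx_suml !linear_sum /=.
rewrite mulr_sumr; apply: eq_bigr => j _.
by rewrite -scalemxAl !linearZ /= basis ?ltn_ord //= mulrCA.
Qed.

Definition rowsmx (r : nat -> L) : 'M[K]_n := \matrix_(i < n) r i.+1.

Lemma x_mul_rowsmx r i : (1 <= i <= n)%N -> x_ i *m rowsmx r = r i.
Proof.
case: i => // i lt_in; have -> : x_ i.+1 = delta_mx 0 (Ordinal lt_in).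
  by apply/rowP=> j; rewrite !mxE eqSS.
by rewrite -rowE rowK.
Qed.

(** The bracket with right multiplications P, Q, S by x_1, x_2, x_3, and 0
    by the other x_j. The matrices act on row vectors, so P *m Q is right
    multiplication by x_1 followed by right multiplication by x_2. *)
Definition bracket3 (P Q S : 'M[K]_n) : bilin L := of_table (fun i j =>
  x_ i *m ((j == 1)%:R *: P + (j == 2)%:R *: Q + (j == 3)%:R *: S)).

Lemma bracket3E P Q S u v :
  bracket3 P Q S u v =
  crd 1 v *: (u *m P) + crd 2 v *: (u *m Q) + crd 3 v *: (u *m S).
Proof.
rewrite of_tableE_gen exchange_big /=.
have -> : crd 1 v *: (u *m P) + crd 2 v *: (u *m Q) + crd 3 v *: (u *m S) =
    u *m \sum_(j < n) v 0 j *: ((j.+1 == 1)%:R *: P + (j.+1 == 2)%:R *: Q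
                                + (j.+1 == 3)%:R *: S).
  rewrite /crd !scaler_suml -!big_split mulmx_sumr /=.
  apply: eq_bigr => j _.
  by rewrite -!scalemxAr !mulmxDr -!scalemxAr !scalerDr !scalerA.
rewrite mulmx_sumr; apply: eq_bigr => j _.
rewrite -scalemxAr [in RHS](x_expansion u) mulmx_suml scaler_sumr.
by apply: eq_bigr => i _; rewrite -scalemxAl scalerA mulrC.
Qed.

Lemma of_table_bracket3 (c : nat -> nat -> L) P Q S :
  (forall i, (1 <= i <= n)%N -> [/\ c i 1%N = x_ i *m P, c i 2 = x_ i *m Q,
     c i 3 = x_ i *m S & forall j, (3 < j)%N -> c i j = 0]) ->
  of_table c = bracket3 P Q S.
Proof.
move=> eq_c; apply/lfunP=> u; apply/lfunP=> v; rewrite !of_tableE_gen.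
apply: eq_bigr => i _; apply: eq_bigr => j _; congr (_ *: _).
have [|c1 c2 c3 c4] := eq_c i.+1; first by rewrite /= ltn_ord.
case: j => [[|[|[|j]]] lt_j] /=.
- by rewrite c1 scale1r !scale0r !addr0.
- by rewrite c2 scale1r !scale0r addr0 add0r.
- by rewrite c3 scale1r !scale0r !add0r.
by rewrite c4 // !scale0r !addr0 mulmx0.
Qed.

Lemma bracket3D P Q S P' Q' S' :
  bracket3 P Q S + bracket3 P' Q' S' = bracket3 (P + P') (Q + Q') (S + S').
Proof.
apply/lfunP=> u; apply/lfunP=> v; rewrite !add_lfunE !bracket3E.
by rewrite !mulmxDr; apply/rowP=> i; rewrite !mxE; ring.
Qed.

Lemma bracket3Z a P Q S :
  a *: bracket3 P Q S = bracket3 (a *: P) (a *: Q) (a *: S).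
Proof.
apply/lfunP=> u; apply/lfunP=> v; rewrite !scale_lfunE !bracket3E.
by rewrite -!scalemxAr; apply/rowP=> i; rewrite !mxE; ring.
Qed.

Lemma bracket30 : bracket3 0 0 0 = 0.
Proof. by rewrite -[RHS](scale0r (bracket3 0 0 0)) bracket3Z !scaler0. Qed.

Lemma bracket3_sum (r : seq nat) (e : nat -> K) (P Q S : nat -> 'M[K]_n) :
  \sum_(k <- r) e k *: bracket3 (P k) (Q k) (S k) =
  bracket3 (\sum_(k <- r) e k *: P k) (\sum_(k <- r) e k *: Q k)
     (\sum_(k <- r) e k *: S k).
Proof.
elim: r => [|k r IHr]; first by rewrite !big_nil bracket30.
by rewrite !big_cons IHr bracket3Z bracket3D.
Qed.

Definition E_ (j k : nat) : 'M[K]_n :=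
  rowsmx (fun i => if i == j then x_ k else 0).

(** With N = shift 1: the power N^m restricted to the span of x_2, ..., x_n,
    and 0 on x_1; in particular shift 0 is a projection. *)
Definition shift (m : nat) : 'M[K]_n :=
  rowsmx (fun i => if (2 <= i)%N then x_ (i + m) else 0).

(** The grading for which x_i has degree i - 2 when i >= 2, and x_1, which
    acts as the shift, has degree 1. *)
Definition degree_mx : 'M[K]_n :=
  rowsmx (fun i => if i == 1%N then x_ 1 else (i - 2)%:R *: x_ i).

Lemma x_E i j k : (1 <= j <= n)%N ->
  x_ i *m E_ j k = if i == j then x_ k else 0.
Proof.
move=> in_j; have [in_i | out_i] := boolP (1 <= i <= n)%N.
  by rewrite x_mul_rowsmx.
rewrite (x_out out_i) mul0mx; case: eqP => // def_i.
by rewrite def_i in_j in out_i.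
Qed.

Lemma x_shift i m : x_ i *m shift m = if (2 <= i)%N then x_ (i + m) else 0.
Proof.
have [in_i | out_i] := boolP (1 <= i <= n)%N; first by rewrite x_mul_rowsmx.
by rewrite (x_out out_i) mul0mx; case: ifP => // ge2_i; rewrite x_out //; lia.
Qed.

Lemma x_degree i :
  x_ i *m degree_mx = if i == 1%N then x_ 1 else (i - 2)%:R *: x_ i.
Proof.
have [in_i | out_i] := boolP (1 <= i <= n)%N; first by rewrite x_mul_rowsmx.
rewrite (x_out out_i) mul0mx scaler0; case: eqP => // def_i.
by rewrite def_i in out_i; rewrite (x_out out_i).
Qed.

Lemma shiftM p q : shift p *m shift q = shift (p + q).
Proof.
apply: mx_basis_eq => i _; rewrite mulmxA !x_shift.
case: ifP => ge2_i; last by rewrite mul0mx.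
by rewrite x_shift addnA (leq_trans ge2_i) ?leq_addr.
Qed.

Lemma shift_large m : (n.-1 <= m)%N -> shift m = 0.
Proof.
move=> ge_m; apply: mx_basis_eq => i _; rewrite x_shift mulmx0.
by case: ifP => // ge2_i; rewrite x_out //; lia.
Qed.

Lemma crd_shift_low i m u : (i < m + 2)%N -> crd i (u *m shift m) = 0.
Proof.
move=> lt_i; rewrite -(mul0r (crd i u)); apply: crd_mulmx => j _.
rewrite mul0r x_shift; case: ifP => ge2_j; rewrite ?linear0 // crd_x.
by case: eqP => //; lia.
Qed.

Lemma crd_shift i m u :
  (m + 2 <= i <= n)%N -> crd i (u *m shift m) = crd (i - m) u.
Proof.
move=> in_i; rewrite -[RHS]mul1r; apply: crd_mulmx => j in_j.
rewrite mul1r x_shift crd_x; case: ifP => ge2_j; last first.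
  by rewrite linear0; case: eqP => //; lia.
by rewrite crd_x; congr (_%:R); congr (nat_of_bool _); lia.
Qed.

Lemma shift_degree m :
  shift m *m degree_mx = degree_mx *m shift m + m%:R *: shift m.
Proof.
apply: mx_basis_eq => i in_i.
rewrite mulmxDr -scalemxAr !mulmxA x_shift x_degree.
case: ifP => ge2_i; last first.
  have ->: i = 1%N by lia.
  by rewrite mul0mx x_shift scaler0 addr0.
rewrite x_degree; have [|_] := eqVneq (i + m)%N 1%N; first lia.
have [|_] := eqVneq i 1%N; first lia.
rewrite -scalemxAl x_shift ge2_i -scalerDl -natrD; congr (_%:R *: _); lia.
Qed.

End Basis.

(** * A differential equation for truncated power series *)

(** The coefficients are found one degree at a time: if the error is
    divisible by X^(m+2), adding t X^(m+2) to q changes the left-hand side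
    by a t (m+2) X^(m+2) and the right-hand side only in higher degree, so
    the current lowest error term can be cancelled as soon as m + 2 is
    invertible. Since the equation starts in degree 2, q has no linear
    term. *)
Lemma exists_ode_poly (K : fieldType) (a : K) (g : {poly K}) (m : nat) :
  [pchar K] =i pred0 -> a != 0 ->
  exists s r, let q := a%:P + 'X^2 * s in
    a *: ('X * q^`()) = 'X^2 * g * q + 'X^m * r.
Proof.
move=> char0 nz_a.
suff [s [r eq_r]]: exists s r, let q := a%:P + 'X^2 * s in
    a *: ('X * q^`()) = 'X^2 * g * q + 'X^(m.+2) * r.
  by exists s, ('X^2 * r); rewrite mulrA -exprD addn2.
elim: m => [|m [s [r eq_r]]].
  exists 0, (- (a *: g)); rewrite /= mulr0 addr0 derivC mulr0 scaler0.
  by rewrite -[a *: g]mul_polyC; ring.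
elim/poly_ind: r eq_r => [|r k _] /= eq_r.
  by exists s, 0; rewrite /= eq_r !mulr0.
pose t := - k / (a * m.+2%:R).
have at_eq : a * t * m.+2%:R = - k.
  have nz_m : m.+2%:R != 0 :> K by rewrite ((pcharf0P K).1 char0).
  by rewrite mulrAC mulrC divfK ?mulf_neq0.
exists (s + t%:P * 'X^m), (r - t%:P * 'X * g) => /=.
have -> : a%:P + 'X^2 * (s + t%:P * 'X^m) =
   (a%:P + 'X^2 * s) + t%:P * 'X^(m.+2).
  by rewrite -(addn2 m) exprD; ring.
rewrite derivD [in X in _ *: (_ * X)]derivM derivC derivXn mul0r add0r.
rewrite mulrDr scalerDr eq_r.
have -> : a *: ('X * (t%:P * ('X^(m.+2.-1) *+ m.+2))) = (- k)%:P * 'X^(m.+2).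
  rewrite /= -at_eq -mul_polyC !polyCM polyC_natr -mulr_natr !exprS; ring.
rewrite polyCN !exprS; ring.
Qed.

(** * The span of the cocycles *)

Section Deformations.
Variables (K : fieldType) (n : nat).
Hypothesis hn : (3 <= n)%N.
Local Notation L := 'rV[K]_n.
Local Notation x_ := (@x_ K n).
Local Notation E_ := (@E_ K n).
Local Notation shift := (@shift K n).
Local Notation N := (shift 1).
Local Notation D := (@degree_mx K n).
Local Notation crd := (@crd K n).

(** Right multiplication by x_1 under a general element of V; e k is the
    coefficient of phi_(n,k) and c that of phi_(1,2). *)
Definition Pmx (c : K) (e : nat -> K) : 'M[K]_n :=
  c *: E_ 1 2 + \sum_(2 <= k < n.+1) e k *: E_ n k.

Definition Tmx (f : nat -> K) : 'M[K]_n :=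
  \sum_(4 <= k < n.+1) f k *: shift (k - 2).

(** Right multiplication by x_2 under a general element of V, with a, b, d,
    f k the coefficients of xi_1, xi_2, psi_2, psi_k. *)
Definition Qmx (a b d : K) (f : nat -> K) : 'M[K]_n :=
  a *: D + b *: E_ 1 n + d *: shift 0 + Tmx f.

Lemma F_n1E : F_n1 K n = bracket3 N 0 0.
Proof.
apply: of_table_bracket3 => i in_i; rewrite !mulmx0 x_shift /=.
split=> // [|[|[|j]]] //; case: ifP => le_i; case: ifP => le2_i //; try lia.
  by rewrite addn1.
by rewrite x_out //; lia.
Qed.

Lemma phiE j k : (1 <= j <= n)%N -> phi_ K n j k = bracket3 (E_ j k) 0 0.
Proof.
move=> in_j; apply: of_table_bracket3 => i in_i; rewrite !mulmx0 x_E //=.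
split; rewrite ?andbT ?andbF //.
by case=> [|[|[|[|l]]]] //= _; rewrite andbF.
Qed.

Lemma psiE k : (2 <= k <= n)%N -> psi_ K n k = bracket3 0 (shift (k - 2)) 0.
Proof.
move=> in_k; apply: of_table_bracket3 => i in_i; rewrite !mulmx0 x_shift /=.
split=> // [|[|[|[|j]]]] //; case: ifP => le_i; case: ifP => le2_i //; try lia.
  by congr x_; lia.
by rewrite x_out //; lia.
Qed.

Lemma xi1E : xi1 K n = bracket3 0 D (- N).
Proof.
apply: of_table_bracket3 => i in_i; rewrite mulmxN !mulmx0 x_shift x_degree /=.
split; rewrite ?andbT ?andbF //=.
- case: eqP => // ne1; case: ifP => // le3.
  by rewrite (_ : (i - 2)%N = 0%N) ?scale0r //; lia.
- case: ifP => le_i; case: ifP => le2_i //; rewrite ?oppr0 //; try lia.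
  by rewrite addn1.
  by rewrite x_out ?oppr0 //; lia.
by case=> [|[|[|[|j]]]] //= _; rewrite !andbF.
Qed.

Lemma xi2E : xi2 K n = bracket3 0 (E_ 1 n) 0.
Proof.
apply: of_table_bracket3 => i in_i; rewrite !mulmx0 x_E ?(leq_trans _ hn) //=.
split; rewrite ?andbT ?andbF //.
by case=> [|[|[|[|l]]]] //= _; rewrite andbF.
Qed.

Lemma x_Pmx c e i : x_ i *m Pmx c e =
  (i == 1%N)%:R *: (c *: x_ 2) +
  (i == n)%:R *: \sum_(2 <= k < n.+1) e k *: x_ k.
Proof.
rewrite mulmxDr -scalemxAr x_E ?(leq_trans _ hn) // mulmx_sumr.
congr (_ + _); first by case: eqP; rewrite ?scale1r ?scale0r ?scaler0.
rewrite scaler_sumr; apply: eq_bigr => k _; rewrite -scalemxAr x_E; last lia.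
by case: eqP; rewrite ?scale1r ?scale0r ?scaler0.
Qed.

Lemma x_Tmx f i : x_ i *m Tmx f =
  (2 <= i)%N%:R *: \sum_(4 <= k < n.+1) f k *: x_ (i + (k - 2)).
Proof.
rewrite mulmx_sumr scaler_sumr; apply: eq_bigr => k _; rewrite -scalemxAr x_shift.
by case: ifP; rewrite ?scale1r ?scale0r ?scaler0.
Qed.

(** The truncations n - 2 and n + 2 - i in the multiplication table are
    automatic, because x_j = 0 for j > n. *)
Lemma alg_F1E theta alpha : alg_F1 n theta alpha =
  bracket3 N (theta *: E_ 1 n + Tmx alpha) 0.
Proof.
apply: of_table_bracket3 => i in_i.
rewrite mulmxDr -scalemxAr x_Tmx mulmx0 x_shift x_E ?(leq_trans _ hn) //=.
split; rewrite ?andbT ?andbF //=.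
- case: ifP => le_i; case: ifP => le2_i //; rewrite ?addn1 //; try lia.
  by rewrite x_out //; lia.
- have [-> | ne1_i] := eqVneq i 1%N; first by rewrite scale0r addr0.
  rewrite scaler0 add0r; have ->: (2 <= i)%N by lia.
  rewrite scale1r; case: ifP => [le_i|gt_i].
    rewrite [RHS](@big_cat_nat _ _ _ (n + 2 - i).+1) /=; [|lia|lia].
    rewrite [X in _ = _ + X]big_nat_cond [X in _ = _ + X]big1 ?addr0.
      by apply: eq_big_nat => k ?; congr (_ *: x_ _); lia.
    by move=> k ?; rewrite x_out ?scaler0 //; lia.
  by rewrite big_nat_cond big1 // => k ?; rewrite x_out ?scaler0 //; lia.
by case=> [|[|[|[|j]]]] //= _; rewrite !andbF.
Qed.

Lemma alg_lambdaE a : alg_lambda n a = bracket3 (N + Pmx (a 1%N) a) 0 0.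
Proof.
apply: of_table_bracket3 => i in_i; rewrite mulmxDr x_Pmx !mulmx0 x_shift /=.
rewrite !andbT; split; rewrite ?andbF //=.
- have [-> | ne1_i] := eqVneq i 1%N.
    have /negbTE->: 1%N != n by lia.
    by rewrite scale0r scale1r addr0 add0r.
  have -> : (1 < i)%N by lia.
  rewrite scale0r add0r; have [->|ne_in] := eqVneq i n.
    rewrite scale1r (@x_out _ _ (n + 1)) ?add0r ?eqxx; last lia.
    by case: ifP => // ?; lia.
  by rewrite scale0r addr0 addn1; case: ifP => // /negbT ?; lia.
by case=> [|[|[|[|j]]]] //= _; rewrite !andbF.
Qed.

Lemma alg_RE : alg_R K n = bracket3 N D (- N).
Proof.
apply: of_table_bracket3 => i in_i.
rewrite mulmxN x_shift x_degree /= !andbT !andbF /=.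
split.
- case: ifP => le_i; case: ifP => le2_i //; try lia.
    by rewrite addn1.
  by rewrite x_out //; lia.
- case: eqP => // ne1; case: ifP => // le3.
  by rewrite (_ : (i - 2)%N = 0%N) ?scale0r //; lia.
- case: ifP => le_i; case: ifP => le2_i //; rewrite ?oppr0 //; try lia.
    by rewrite addn1.
  by rewrite x_out ?oppr0 //; lia.
by case=> [|[|[|[|j]]]] //= _; rewrite !andbF.
Qed.

Lemma sum_scale0 (r : seq nat) (e : nat -> K) :
  \sum_(k <- r) e k *: 0 = 0 :> 'M[K]_n.
Proof. by rewrite big1 // => k _; rewrite scaler0. Qed.

Lemma V_repsP (phi : bilin L) : phi \in V_reps K n <->
  exists a b c d e f, phi = bracket3 (Pmx c e) (Qmx a b d f) (- (a *: N)).
Proof.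
have sum_phi e : \sum_(k <- index_iota 2 n.+1) e k *: phi_ K n n k =
    bracket3 (\sum_(k <- index_iota 2 n.+1) e k *: E_ n k) 0 0.
  under eq_bigr do rewrite phiE ?leqnn ?(leq_trans _ hn) //.
  by rewrite bracket3_sum !sum_scale0.
have sum_psi f : \sum_(k <- index_iota 4 n.+1) f k *: psi_ K n k =
    bracket3 0 (Tmx f) 0.
  rewrite (eq_big_seq (fun k => f k *: bracket3 0 (shift (k - 2)) 0)); last first.
    by move=> k; rewrite mem_index_iota => ?; rewrite psiE //; lia.
  by rewrite bracket3_sum !sum_scale0.
have combine a b c d e f :
    a *: xi1 K n + (b *: xi2 K n + (c *: phi_ K n 1 2 + (d *: psi_ K n 2 +
      (\sum_(k <- index_iota 2 n.+1) e k *: phi_ K n n k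
       + \sum_(k <- index_iota 4 n.+1) f k *: psi_ K n k)))) =
    bracket3 (Pmx c e) (Qmx a b d f) (- (a *: N)).
  rewrite xi1E xi2E phiE ?psiE ?sum_phi ?sum_psi; try lia.
  rewrite !bracket3Z !bracket3D !scaler0 !(addr0, add0r) scalerN.
  by rewrite /Qmx !addrA.
rewrite /V_reps !span_cat !span_cons span_nil addv0 -!addvA; split.
  case/memv_addP=> _ /vlineP[a ->] [w1 w1V ->].
  case/memv_addP: w1V => _ /vlineP[b ->] [w2 w2V ->].
  case/memv_addP: w2V => _ /vlineP[c ->] [w3 w3V ->].
  case/memv_addP: w3V => _ /vlineP[d ->] [w4 w4V ->].
  case/memv_addP: w4V => w5 w5V [w6 w6V ->].
  have [/(_ w5V)[e ->] _] :=
    span_mapP (phi_ K n n) w5 (iota_uniq 2 (n.+1 - 2)).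
  have [/(_ w6V)[f ->] _] :=
    span_mapP (psi_ K n) w6 (iota_uniq 4 (n.+1 - 4)).
  by exists a, b, c, d, e, f; rewrite combine.
case=> [a [b [c [d [e [f ->]]]]]]; rewrite -combine.
do 4!(apply: memv_add; first exact/memvZ/memv_line).
by apply: memv_add; apply/span_mapP; rewrite ?iota_uniq //; [exists e | exists f].
Qed.

Lemma crd_E i j k u : (1 <= j <= n)%N -> (1 <= i <= n)%N ->
  crd i (u *m E_ j k) = (i == k)%:R * crd j u.
Proof.
move=> in_j in_i; apply: crd_mulmx => l in_l; rewrite x_E // !crd_x in_j andbT.
rewrite [j == l]eq_sym; case: eqP => _; last by rewrite linear0 mulr0.
by rewrite crd_x in_i andbT mulr1.
Qed.

Lemma crd1_Pmx c e u : crd 1 (u *m Pmx c e) = 0.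
Proof.
rewrite mulmxDr -scalemxAr mulmx_sumr linearD linearZ linear_sum /=.
rewrite crd_E; try lia; rewrite mul0r mulr0 add0r big_seq big1 // => k.
rewrite mem_index_iota => in_k; rewrite -scalemxAr linearZ /= crd_E; try lia.
by case: eqP => [|_]; [lia | rewrite mul0r mulr0].
Qed.

Lemma crd_Tmx i f u : (i <= 3)%N -> crd i (u *m Tmx f) = 0.
Proof.
move=> le3_i; rewrite mulmx_sumr linear_sum big_seq big1 // => k.
rewrite mem_index_iota => in_k; rewrite -scalemxAr linearZ /=.
by rewrite crd_shift_low ?mulr0 //; lia.
Qed.

Lemma crd_degree i u : (1 <= i <= n)%N ->
  crd i (u *m D) = (if i == 1%N then 1 else (i - 2)%:R) * crd i u.
Proof.
move=> in_i; apply: crd_mulmx => j _; rewrite x_degree.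
have [-> | ne1_j] := eqVneq j 1%N.
  by rewrite !crd_x; case: eqP => [->|]; rewrite ?mul1r ?mulr0.
rewrite linearZ /= !crd_x; have [->|] := eqVneq i j; last by rewrite !mulr0.
by rewrite (negbTE ne1_j).
Qed.

Lemma crd_Qmx i a b d f u : (1 <= i <= 2)%N ->
  crd i (u *m Qmx a b d f) = (if i == 1%N then a else d) * crd i u.
Proof.
move=> in_i; rewrite !mulmxDr -!scalemxAr !linearD !linearZ /=.
rewrite crd_Tmx ?crd_degree ?crd_E; try lia.
have /negbTE->: i != n by lia.
rewrite !mul0r mulr0 !addr0; have [-> | ne1] := eqVneq i 1%N.
  by rewrite crd_shift_low // mulr0 addr0 mul1r.
have ->: i = 2 by lia.
by rewrite crd_shift ?subn0 ?mul0r ?mulr0 ?add0r //; lia.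
Qed.

Lemma E_shift m : (0 < m)%N -> E_ 1 n *m shift m = 0.
Proof.
move=> m_gt0; apply: mx_basis_eq => i _; rewrite mulmxA mulmx0 x_E; last lia.
case: ifP => _; rewrite ?mul0mx // x_shift.
by case: ifP => // _; rewrite x_out //; lia.
Qed.

Lemma shift_E m k : shift m *m E_ 1 k = 0.
Proof.
apply: mx_basis_eq => i _; rewrite mulmxA mulmx0 x_shift.
case: ifP => ge2; rewrite ?mul0mx // x_E; last lia.
by case: eqP => //; lia.
Qed.

Lemma Tmx_shift f m : Tmx f *m shift m = shift m *m Tmx f.
Proof.
rewrite mulmx_suml mulmx_sumr; apply: eq_bigr => k _.
by rewrite -scalemxAl -scalemxAr !shiftM addnC.
Qed.

(** Q is a sum of a D and of terms commuting with N. *)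
Lemma N_Qmx a b d f : N *m Qmx a b d f = Qmx a b d f *m N + a *: N.
Proof.
rewrite !mulmxDr !mulmxDl -!scalemxAr -!scalemxAl Tmx_shift shift_degree shift_E.
rewrite E_shift // !scaler0 !shiftM scale1r addn0 add0n scalerDr.
by apply/matrixP=> i j; rewrite !mxE; ring.
Qed.

(** Right multiplication by phi(y, z) in F_n^1 only sees the coordinate
    a y_1 z_2 on x_1, and phi(x, [y, z]) only the coordinate y_2 z_1 of
    [y, z] on x_3; the rest of the cocycle expression is made of commutators with
    N. Those of N with P cancel by antisymmetry in y, z, S commutes with N,
    and the terms in Q add up by the relation N Q = Q N + a N. *)
Lemma V_cocycle a b c d e f :
  cocycle2 (F_n1 K n) (bracket3 (Pmx c e) (Qmx a b d f) (- (a *: N))).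
Proof.
move=> x y z; rewrite F_n1E !bracket3E.
rewrite !mulmx0 !scaler0 !addr0 !mulmxN !crdD !crdZ !crdN.
rewrite -!scalemxAr !crdZ !crd1_Pmx !crd_Qmx //=.
rewrite !(crd_shift_low (i := 1)) // !(crd_shift_low (i := 2)) //.
rewrite !(crd_shift (i := 3)) // -?scalerA.
have NQ : x *m N *m Qmx a b d f = x *m Qmx a b d f *m N + a *: (x *m N).
  by rewrite -!mulmxA N_Qmx mulmxDr -scalemxAr.
rewrite !mulmxDl -!scalemxAl !mulNmx -!scalemxAl NQ.
move: (x *m N *m N) (x *m Qmx a b d f *m N) (x *m Pmx c e *m N).
move: (x *m N *m Pmx c e) (x *m N) (x *m Pmx c e) (x *m Qmx a b d f).
move=> w1 w2 w3 w4 w5 w6 w7; apply/rowP=> i; rewrite !mxE; ring.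
Qed.

Lemma x_Qmx a b d f i : x_ i *m Qmx a b d f =
  a *: (if i == 1%N then x_ 1 else (i - 2)%:R *: x_ i) +
  b *: (if i == 1%N then x_ n else 0) +
  d *: (if (2 <= i)%N then x_ i else 0) + x_ i *m Tmx f.
Proof. by rewrite !mulmxDr -!scalemxAr x_degree x_E ?x_shift ?addn0 //; lia. Qed.

Lemma bracket3_x1 P Q S u : bracket3 P Q S u (x_ 1) = u *m P.
Proof.
rewrite bracket3E !crd_x /= (_ : (0 < n)%N) ?(leq_trans _ hn) //.
by rewrite !scale0r !addr0 scale1r.
Qed.

Lemma bracket3_x2 P Q S u : bracket3 P Q S u (x_ 2) = u *m Q.
Proof.
rewrite bracket3E !crd_x /= (_ : (1 < n)%N) ?(leq_trans _ hn) //.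
by rewrite !scale0r !addr0 add0r scale1r.
Qed.

Lemma x_neq0 i : (1 <= i <= n)%N -> x_ i != 0.
Proof.
move=> in_i; apply/eqP=> x_i0; have := @crd_x K n i i.
by rewrite x_i0 linear0 eqxx in_i => /eqP; rewrite eq_sym oner_eq0.
Qed.

Lemma scale_basis_eq0 (k : K) (A : 'M[K]_n) :
  (forall i, (1 <= i <= n)%N -> k *: (x_ i *m A) = 0) -> k = 0 \/ A = 0.
Proof.
move=> kA0; have [-> | nz_k] := eqVneq k 0; [by left | right].
apply: mx_basis_eq => i in_i; apply/eqP; rewrite mulmx0.
by have /eqP := kA0 i in_i; rewrite scaler_eq0 (negbTE nz_k).
Qed.

(** * Consequences of integrability *)

Section Integrable.
Variables (a b c d : K) (e f : nat -> K).
Let P := Pmx c e.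
Let Q := Qmx a b d f.
Let phi := bracket3 P Q (- (a *: N)).
Hypothesis phi_int : forall x y z : L,
  phi x (phi y z) - phi (phi x y) z + phi (phi x z) y = 0.

Lemma x1_Pmx : x_ 1 *m P = c *: x_ 2.
Proof.
rewrite x_Pmx eqxx scale1r; have /negbTE->: 1%N != n by lia.
by rewrite scale0r addr0.
Qed.

Lemma x_mid_Pmx i : (2 <= i <= n - 1)%N -> x_ i *m P = 0.
Proof.
move=> in_i; rewrite x_Pmx; have /negbTE->: i != 1%N by lia.
have /negbTE->: i != n by lia.
by rewrite !scale0r addr0.
Qed.

(** The pair (x_2, x_2): phi(x_2, x_2) is d x_2 plus terms in x_4, ..., x_n,
    so d Q = 0, and Q has the eigenvalue d on x_2 modulo x_4, ..., x_n. *)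
Lemma integrable_d0 : d = 0.
Proof.
have := phi_int (x_ 2) (x_ 2) (x_ 2); rewrite addrNK !bracket3_x2.
rewrite /phi bracket3E (crd_Qmx (i := 1)) // (crd_Qmx (i := 2)) //.
rewrite (@crd_x K n 1) mulr0 scale0r add0r.
have -> : crd 3 (x_ 2 *m Q) = 0.
  rewrite x_Qmx /= subnn scale0r !scaler0 !add0r crdD crdZ crd_Tmx //.
  by rewrite crd_x mulr0 addr0.
rewrite scale0r addr0 => /(congr1 (crd 2)); rewrite linear0 crdZ crd_Qmx //.
rewrite crd_x /= (_ : (1 < n)%N) ?(leq_trans _ hn) // !mulr1.
by move/eqP; rewrite mulf_eq0 orbb => /eqP.
Qed.

(** The pair (x_2, x_1), where phi(x_2, x_1) = 0 because 2 < n. *)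
Lemma integrable_comm : P *m Q = Q *m P.
Proof.
apply: mx_basis_eq => i _; rewrite !mulmxA; have := phi_int (x_ i) (x_ 2) (x_ 1).
rewrite !bracket3_x1 !bracket3_x2 (x_mid_Pmx (i := 2)) ?linear0 ?add0r; last lia.
by rewrite addrC => /eqP; rewrite subr_eq0 => /eqP.
Qed.

(** The pair (x_1, x_1), where phi(x_1, x_1) = c x_2. *)
Lemma integrable_cQ : c = 0 \/ Q = 0.
Proof.
apply: scale_basis_eq0 => i _; have := phi_int (x_ i) (x_ 1) (x_ 1).
by rewrite addrNK !bracket3_x1 x1_Pmx linearZ /= bracket3_x2.
Qed.

(** The pair (x_1, x_2), where phi(x_1, x_2) = a x_1 + b x_n, gives
    a P + b M = 0 with M the right multiplication by x_n under phi; M is 0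
    unless n = 3, when it is - a N. Testing on x_2, which P kills and N does not, removes the
    second term. *)
Lemma integrable_a_neq0 : a != 0 -> P = 0 /\ b * (n == 3)%:R = 0.
Proof.
move=> nz_a; have x1Q: x_ 1 *m Q = a *: x_ 1 + b *: x_ n.
  by rewrite x_Qmx x_Tmx /= scale0r scaler0 !addr0.
have eqn i : a *: (x_ i *m P) = (b * (n == 3)%:R * a) *: (x_ i *m N).
  have := phi_int (x_ i) (x_ 1) (x_ 2).
  rewrite !bracket3_x1 !bracket3_x2 -!mulmxA integrable_comm addrNK x1Q.
  rewrite linearD !linearZ /= bracket3_x1 /phi bracket3E !crd_x [3 == n]eq_sym.
  have /negbTE->: 1%N != n by lia.
  have /negbTE->: 2 != n by lia.
  rewrite !scale0r !add0r mulmxN -scalemxAr scalerN scalerN.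
  by rewrite hn /= andbT; move/eqP; rewrite subr_eq0 => /eqP->; rewrite !scalerA.
have b3 : b * (n == 3)%:R = 0.
  have := eqn 2; rewrite (x_mid_Pmx (i := 2)) ?scaler0; last lia.
  rewrite x_shift => /esym/eqP; rewrite scaler_eq0 !mulf_eq0 (negbTE nz_a) orbF.
  by rewrite (negbTE (x_neq0 _)) ?orbF -?mulf_eq0 => // /eqP.
split=> //; have [a0 | //] : a = 0 \/ P = 0; last by rewrite a0 eqxx in nz_a.
by apply: scale_basis_eq0 => i _; rewrite eqn b3 mul0r scale0r.
Qed.

(** When c <> 0, Q = 0. If c = 0 the matrix P has rank at most one: it sends
    x_n to a vector w and kills the other x_i. If w <> 0, then for i <> n
    the vector 0 = x_i P Q = x_i Q P is w times the x_n-coordinate of x_i Q,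
    so that coordinate is 0; it is b for i = 1 and f k for i = n + 2 - k. *)
Lemma integrable_a_eq0 : a = 0 -> Q = 0 \/ P = 0.
Proof.
move=> a0; have [c0 | ->] := integrable_cQ; last by left.
have xP i : i != n -> x_ i *m P = 0.
  by move=> ne_in; rewrite x_Pmx (negbTE ne_in) c0 !scale0r scaler0 addr0.
have uP (u : L) : u *m P = crd n u *: (x_ n *m P).
  rewrite [in LHS](x_expansion u) mulmx_suml scaler_suml; apply: eq_bigr => i _.
  rewrite -scalemxAl; case: eqP => [-> | /eqP/xP ->]; first by rewrite mulr1.
  by rewrite mulr0 scale0r scaler0.
have [xnP0 | nz_xnP] := eqVneq (x_ n *m P) 0.
  by right; apply: mx_basis_eq => i _; rewrite uP xnP0 scaler0 mulmx0.
have xQ i : i != n -> crd n (x_ i *m Q) = 0.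
  move=> ne_in; have /eqP := congr1 (mulmx (x_ i)) integrable_comm.
  rewrite !mulmxA xP // mul0mx eq_sym uP scaler_eq0 (negbTE nz_xnP) orbF.
  by move/eqP.
have b0 : b = 0.
  have := xQ 1%N; rewrite x_Qmx x_Tmx a0 !scale0r scaler0 !addr0 add0r crdZ.
  by rewrite crd_x eqxx leqnn andbT (_ : (0 < n)%N) ?mulr1; [apply|]; lia.
have f0 k : (4 <= k <= n)%N -> f k = 0.
  move=> in_k; have := xQ (n + 2 - k)%N.
  rewrite x_Qmx a0 b0 integrable_d0 !scale0r !add0r x_Tmx.
  have -> : (2 <= n + 2 - k)%N by lia.
  rewrite scale1r linear_sum (bigD1_seq k) ?mem_index_iota ?iota_uniq //=.
  rewrite big_seq_cond big1 ?addr0.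
    rewrite crdZ crd_x (_ : (n == _) && _) ?mulr1; [by apply; lia | lia].
  move=> j; rewrite mem_index_iota => in_j; rewrite crdZ crd_x.
  by rewrite (_ : (n == _) = false) ?mulr0 //; apply/eqP; lia.
left; rewrite /Q /Qmx a0 b0 integrable_d0 !scale0r !add0r /Tmx.
rewrite big_seq big1 // => k.
by rewrite mem_index_iota => in_k; rewrite f0 ?scale0r.
Qed.
End Integrable.

(** * The isomorphism with R *)

Lemma iso_mulmx (mu nu : bilin L) (H : 'M[K]_n) :
  H \in unitmx -> (forall u v : L, mu u v *m H = nu (u *m H) (v *m H)) ->
  isomorphic mu nu.
Proof.
move=> unitH homH; exists (linfun (mulmxr H)) => [|u v]; last first.
  by rewrite !lfunE /= homH.
exists (linfun (mulmxr (invmx H))) => u; rewrite !lfunE /= ?mulmxK //.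
by rewrite mulmxKV.
Qed.

(** The value p(N) on the span of x_2, ..., x_n, and 0 on x_1; the
    truncation of p at degree n is harmless since shift i = 0 for
    i >= n - 1. *)
Definition shift_poly (p : {poly K}) : 'M[K]_n :=
  \sum_(0 <= i < n) p`_i *: shift i.
Local Notation Phi := shift_poly.

Lemma shift_polyD p q : Phi (p + q) = Phi p + Phi q.
Proof.
by rewrite -big_split; apply: eq_bigr => i _; rewrite coefD scalerDl.
Qed.

Lemma shift_polyZ k p : Phi (k *: p) = k *: Phi p.
Proof.
by rewrite scaler_sumr; apply: eq_bigr => i _; rewrite coefZ scalerA.
Qed.

Lemma shift_poly_sum (r : seq nat) (F : nat -> {poly K}) :
  Phi (\sum_(k <- r) F k) = \sum_(k <- r) Phi (F k).
Proof.
elim: r => [|k r IHr]; last by rewrite !big_cons shift_polyD IHr.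
by rewrite !big_nil /Phi big1 // => i _; rewrite coef0 scale0r.
Qed.

(** The monomial case of multiplicativity; Tmx_poly follows by linearity. *)
Lemma shift_polyXnM m p : Phi ('X^m * p) = shift m *m Phi p.
Proof.
(* The sum may be extended past degree n, which makes room for the shift. *)
have extend q : Phi q = \sum_(0 <= i < m + n) q`_i *: shift i.
  rewrite [RHS](@big_cat_nat _ _ _ n) ?leq_addl //=.
  rewrite [X in _ = _ + X]big_nat_cond [X in _ = _ + X]big1 ?addr0 // => i in_i.
  by rewrite shift_large ?scaler0 //; lia.
rewrite extend (@big_cat_nat _ _ _ m) ?leq_addr //=.
rewrite big_nat_cond big1 ?add0r => [|i in_i]; last first.
  by rewrite coefXnM (_ : (i < m)%N) ?scale0r //; lia.
rewrite -{1}[m]add0n big_addn addKn mulmx_sumr; apply: eq_bigr => i _.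
rewrite coefXnM (_ : (i + m < m)%N = false); last lia.
by rewrite addnK -scalemxAr shiftM addnC.
Qed.

Lemma shift_polyC k : Phi k%:P = k *: shift 0.
Proof.
rewrite /Phi big_ltn ?(leq_trans _ hn) // coefC big_nat_cond big1 ?addr0 // => i.
by rewrite coefC; case: i => // i _; rewrite scale0r.
Qed.

Lemma shift_poly_comm m p : Phi p *m shift m = shift m *m Phi p.
Proof.
rewrite mulmx_suml mulmx_sumr; apply: eq_bigr => i _.
by rewrite -scalemxAl -scalemxAr !shiftM addnC.
Qed.

(** Commuting with the degree operator is the Euler derivation p -> X p',
    which turns the isomorphism condition into a differential equation. *)
Lemma shift_poly_degree p : Phi p *m D = D *m Phi p + Phi ('X * p^`()).
Proof.
rewrite mulmx_suml mulmx_sumr -big_split; apply: eq_bigr => i _.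
rewrite -scalemxAl -scalemxAr shift_degree scalerDr scalerA; congr (_ + _ *: _).
by rewrite coefXM coef_deriv; case: i => [|i] /=; rewrite ?mulr0 ?mulr_natr.
Qed.

Lemma Tmx_poly f q :
  Tmx f *m Phi q = Phi ((\sum_(4 <= k < n.+1) f k *: 'X^(k - 2)) * q).
Proof.
rewrite mulmx_suml mulr_suml shift_poly_sum; apply: eq_bigr => k _.
by rewrite -scalemxAl -scalerAl shift_polyZ shift_polyXnM.
Qed.

Lemma degree_E k : D *m E_ 1 k = E_ 1 k.
Proof.
apply: mx_basis_eq => i in_i; rewrite mulmxA x_degree.
have [-> // | ne1_i] := eqVneq i 1%N.
by rewrite -scalemxAl x_E ?(negbTE ne1_i) ?scaler0 //; lia.
Qed.

Lemma E_degree k : k != 1%N -> E_ 1 k *m D = (k - 2)%:R *: E_ 1 k.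
Proof.
move=> ne1_k; apply: mx_basis_eq => i in_i; rewrite mulmxA -scalemxAr x_E; last lia.
by case: ifP; rewrite ?mul0mx ?scaler0 // x_degree (negbTE ne1_k).
Qed.

Lemma E11_degree : E_ 1 1 *m D = E_ 1 1.
Proof.
apply: mx_basis_eq => i in_i; rewrite mulmxA x_E; last lia.
by case: ifP; rewrite ?mul0mx // x_degree.
Qed.

Lemma E11_shift m : E_ 1 1 *m shift m = 0.
Proof.
apply: mx_basis_eq => i in_i; rewrite mulmxA x_E ?mulmx0; last lia.
by case: ifP; rewrite ?mul0mx // x_shift.
Qed.

Lemma E_E k l : k != 1%N -> E_ 1 k *m E_ 1 l = 0.
Proof.
move=> ne1_k; apply: mx_basis_eq => i in_i; rewrite mulmxA x_E ?mulmx0; last lia.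
by case: ifP; rewrite ?mul0mx // x_E ?(negbTE ne1_k) //; lia.
Qed.

Lemma E_shift0 : E_ 1 n *m shift 0 = E_ 1 n.
Proof.
apply: mx_basis_eq => i in_i; rewrite mulmxA x_E; last lia.
by case: ifP; rewrite ?mul0mx // x_shift addn0 (leq_trans _ hn).
Qed.

Section ChangeOfBasis.
Variables (a b : K) (s : {poly K}).
Let q := a%:P + 'X^2 * s.
Let beta := b / (n - 3)%:R.
Let H := E_ 1 1 + beta *: E_ 1 n + Phi q.

Lemma shift_poly_q : Phi q = a *: shift 0 + shift 2 *m Phi s.
Proof. by rewrite shift_polyD shift_polyC shift_polyXnM. Qed.

(** H is upper triangular with diagonal 1, a, ..., a. *)
Lemma unitmx_H : a != 0 -> H \in unitmx.
Proof.
move=> nz_a; have shiftE m (i j : 'I_n) :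
    shift m i j = ((0 < i)%N && (j == i + m :> nat)%N)%:R.
  by rewrite mxE -[(0 < i)%N]/(1 < i.+1)%N; case: ifP => _; rewrite !mxE.
have E1E k (i j : 'I_n) : E_ 1 k i j = ((i == 0 :> nat)%N && (j.+1 == k))%:R.
  by rewrite mxE eqSS; case: ifP => _; rewrite !mxE.
have PhiE (i j : 'I_n) : (j <= i)%N ->
    Phi q i j = ((0 < i)%N && (j == i))%:R * a.
  move=> le_ji; rewrite summxE big_ltn ?(leq_trans _ hn) //.
  rewrite big_nat_cond big1 ?addr0 => [|m in_m]; last first.
    rewrite mxE shiftE (_ : (j == i + m :> nat)%N = false) ?andbF ?mulr0 //.
    by apply/eqP; lia.
  rewrite mxE shiftE addn0 mulrC coefD coefC coefXnM /= addr0 //.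
have HE (i j : 'I_n) :
    H i j = E_ 1 1 i j + beta * E_ 1 n i j + Phi q i j.
  by rewrite [LHS]mxE [X in X + _]mxE [X in _ + X + _]mxE.
rewrite unitmxE -det_tr det_trig.
  rewrite unitfE; apply/prodf_neq0 => i _; rewrite mxE HE !E1E PhiE // eqxx andbT.
  have [i0 | i_gt0] := posnP i.
    rewrite i0 /= mul0r addr0 (_ : (1%N == n) = false) ?mulr0 ?addr0 ?oner_eq0 //.
    by apply/eqP; lia.
  by rewrite mulr0 !add0r mul1r.
apply/is_trig_mxP=> i j lt_ij; rewrite mxE HE !E1E PhiE ?(ltnW lt_ij) //.
have /negbTE-> : j != 0 :> nat by rewrite -lt0n (leq_ltn_trans _ lt_ij).
have /negbTE-> : i != j by rewrite neq_ltn lt_ij.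
by rewrite andbF mulr0 mul0r !addr0.
Qed.

Lemma crd_shift_poly_q i u : (2 <= i <= 3)%N -> crd i (u *m Phi q) = a * crd i u.
Proof.
move=> in_i; rewrite shift_poly_q -shift_poly_comm mulmxDr -scalemxAr crdD crdZ.
rewrite mulmxA (crd_shift_low (m := 2)) ?addr0 ?crd_shift ?subn0 //; lia.
Qed.

Lemma crd1_H u : crd 1 (u *m H) = crd 1 u.
Proof.
rewrite !mulmxDr -scalemxAr !crdD crdZ !crd_E; try lia.
rewrite shift_poly_q -shift_poly_comm mulmxDr -scalemxAr crdD crdZ mulmxA.
rewrite !crd_shift_low // (_ : (1%N == n) = false); last by apply/eqP; lia.
by rewrite mul0r !mulr0 !addr0 mul1r.
Qed.

Lemma crd2_H u : crd 2 (u *m H) = a * crd 2 u.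
Proof.
rewrite !mulmxDr -scalemxAr !crdD crdZ !crd_E ?crd_shift_poly_q; try lia.
rewrite (_ : (2 == n) = false); last by apply/eqP; lia.
by rewrite !mul0r mulr0 !add0r.
Qed.

Lemma crd3_H u :
  crd 3 (u *m H) = beta * (3 == n)%:R * crd 1 u + a * crd 3 u.
Proof.
rewrite !mulmxDr -scalemxAr !crdD crdZ !crd_E ?crd_shift_poly_q; try lia.
by rewrite mul0r add0r mulrA.
Qed.

End ChangeOfBasis.

(** The isomorphism sends x_1 to x_1 + beta x_n and x_i to q(N) x_i for
    i >= 2. Since q = a + O(X^2), the image of x_2 is a x_2 modulo x_4, ..., x_n,
    so it acts on R from the right as a D, and the condition on x_2 reads
    Q H = a H D. On x_1 it says a beta (n - 2) = a beta + a b, and on the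
    other x_i it is the differential equation for q. *)
Lemma iso_alg_R a b f : [pchar K] =i pred0 -> a != 0 -> b * (n == 3)%:R = 0 ->
  isomorphic (bracket3 N (Qmx a b 0 f) (- (a *: N))) (alg_R K n).
Proof.
move=> char0 nz_a b3.
pose g := \sum_(4 <= k < n.+1) f k *: 'X^(k - 4) : {poly K}.
have [s [r /= ode]] := exists_ode_poly g n char0 nz_a.
set q := a%:P + 'X^2 * s in ode.
pose beta := b / (n - 3)%:R; pose H := E_ 1 1 + beta *: E_ 1 n + Phi q.
have nE1 : n != 1%N by lia.
have gE : \sum_(4 <= k < n.+1) f k *: 'X^(k - 2) = 'X^2 * g.
  rewrite mulr_sumr; apply: eq_big_nat => k in_k.
  by rewrite -scalerAr -exprD; congr (_ *: 'X^_); lia.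
(* When n = 3, beta is b / 0 = 0 and b itself is 0, so the relation persists. *)
have betaE : a * beta * (n - 2)%:R = a * beta + b * a.
  have -> : (n - 2 = (n - 3).+1)%N by lia.
  rewrite -natr1 mulrDr mulr1 addrC; congr (_ + _).
  have [n3 | ne3] := eqVneq n 3.
    by move: b3; rewrite n3 eqxx mulr1 => ->; rewrite mulr0 mul0r.
  rewrite -mulrA divfK 1?mulrC // ((pcharf0P K).1 char0); lia.
have HN : H *m N = N *m H.
  rewrite !mulmxDl !mulmxDr -scalemxAl -scalemxAr E11_shift E_shift // !shift_E.
  by rewrite !scaler0 !add0r shift_poly_comm.
have QH : Qmx a b 0 f *m H = a *: (H *m D).
  have TPhi : Tmx f *m Phi q = a *: (Phi q *m D - D *m Phi q).
    rewrite Tmx_poly gE shift_poly_degree addrC addKr -shift_polyZ ode shift_polyD.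
    by rewrite shift_polyXnM shift_large ?leq_pred // mul0mx addr0.
  have EPhi : E_ 1 n *m Phi q = a *: E_ 1 n.
    by rewrite shift_poly_q mulmxDr -scalemxAr E_shift0 mulmxA E_shift // mul0mx addr0.
  have TE k : Tmx f *m E_ 1 k = 0.
    by rewrite mulmx_suml big1 // => j _; rewrite -scalemxAl shift_E scaler0.
  rewrite /Qmx scale0r addr0 !mulmxDl !mulmxDr -!scalemxAl -!scalemxAr.
  rewrite !degree_E !E_E // EPhi !TE TPhi E11_degree E_degree // !scalerA !scaler0.
  move: (E_ 1 1) (E_ 1 n) (Phi q *m D) (D *m Phi q) => A B C1 C2.
  apply/matrixP=> i j; rewrite !mxE.
  move: betaE; move: (n - 2)%:R => k betaE.
  transitivity (a * A i j + (a * beta * k) * B i j + a * C1 i j); last ring.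
  by rewrite betaE; ring.
apply: (@iso_mulmx _ _ H); first exact: unitmx_H.
have beta3 : beta * (3 == n)%:R = 0.
  by rewrite /beta -mulrA [_^-1 * _]mulrC mulrA eq_sym b3 mul0r.
move=> u v; rewrite alg_RE !bracket3E crd1_H crd2_H crd3_H beta3 mul0r add0r.
rewrite !mulmxDl -!scalemxAl !mulmxN -!scalemxAr mulNmx -!scalemxAl -!mulmxA.
rewrite QH HN -scalemxAr; apply/rowP=> i; rewrite !mxE; ring.
Qed.

(** * The classification *)

Lemma integrable_bracket3_P P :
  (forall u : L, crd 1 (u *m P) = 0) -> forall x y z : L,
  let phi := bracket3 P 0 0 in
  phi x (phi y z) - phi (phi x y) z + phi (phi x z) y = 0.
Proof.
move=> P1 x y z /=; rewrite !bracket3E !mulmx0 !scaler0 !addr0 crdZ P1 mulr0 scale0r.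
by rewrite -!scalemxAl !scalerA mulrC add0r addNr.
Qed.

Lemma integrable_bracket3_Q Q :
  (forall u : L, crd 2 (u *m Q) = 0) -> forall x y z : L,
  let phi := bracket3 0 Q 0 in
  phi x (phi y z) - phi (phi x y) z + phi (phi x z) y = 0.
Proof.
move=> Q2 x y z /=; rewrite !bracket3E !mulmx0 !scaler0 !addr0 !add0r crdZ Q2 mulr0.
by rewrite scale0r -!scalemxAl !scalerA mulrC add0r addNr.
Qed.

Lemma integrable_xi1 (x y z : L) :
  let phi := bracket3 0 D (- N) in
  phi x (phi y z) - phi (phi x y) z + phi (phi x z) y = 0.
Proof.
rewrite /= !bracket3E !mulmx0 !scaler0 !add0r !mulmxN !crdD !crdZ !crdN.
rewrite !crd_degree ?(crd_shift_low (i := 2)) ?(crd_shift (i := 3)) //=; try lia.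
rewrite subnn -[(3 - 1)%N]/2%N -[(3 - 2)%N]/1%N.
have ND : x *m N *m D = x *m D *m N + x *m N.
  by rewrite -!mulmxA shift_degree mulmxDr scale1r.
rewrite !mulmxDl -!scalemxAl !mulNmx ND.
move: (x *m D *m D) (x *m N *m N) (x *m D *m N).
move: (x *m N) (x *m D) => w1 w2 w3 w4 w5.
by apply/rowP=> i; rewrite !mxE; ring.
Qed.

Lemma deformations_listed (phi : bilin L) :
  [pchar K] =i pred0 -> phi \in V_reps K n ->
  linear_integrable (F_n1 K n) phi ->
  exists2 mu : bilin L, listed mu & isomorphic (F_n1 K n + phi) mu.
Proof.
move=> char0 /V_repsP[a [b [c [d [e [f def_phi]]]]]] [_ phi_int]; subst phi.
have d0 := integrable_d0 phi_int; have [a0 | nz_a] := eqVneq a 0.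
  have [Q0 | P0] := integrable_a_eq0 phi_int a0.
    pose e' k := if k == 1%N then c else e k.
    have e'E : Pmx c e = Pmx (e' 1%N) e'.
      by rewrite /Pmx; congr (_ + _); apply: eq_big_nat => -[|[|k]].
    exists (alg_lambda n e'); first by constructor 2; exists e'.
    rewrite F_n1E Q0 a0 scale0r oppr0 bracket3D !addr0 alg_lambdaE e'E.
    exact: iso_refl.
  exists (alg_F1 n b f); first by constructor 1; exists b, f.
  rewrite F_n1E P0 a0 d0 /Qmx !scale0r oppr0 addr0 add0r bracket3D !add0r !addr0.
  by rewrite alg_F1E; exact: iso_refl.
have [P0 b3] := integrable_a_neq0 phi_int nz_a.
exists (alg_R K n); first by constructor 3.
by rewrite F_n1E P0 d0 bracket3D addr0 !add0r; exact: iso_alg_R.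
Qed.

Lemma listed_deformations (mu : bilin L) : listed mu ->
  exists phi : bilin L,
    [/\ phi \in V_reps K n, linear_integrable (F_n1 K n) phi
      & isomorphic (F_n1 K n + phi) mu].
Proof.
have realize a b c e f : (forall x y z : L,
    let phi := bracket3 (Pmx c e) (Qmx a b 0 f) (- (a *: N)) in
    phi x (phi y z) - phi (phi x y) z + phi (phi x z) y = 0) ->
  bracket3 (N + Pmx c e) (Qmx a b 0 f) (- (a *: N)) = mu ->
  exists phi : bilin L,
    [/\ phi \in V_reps K n, linear_integrable (F_n1 K n) phi
      & isomorphic (F_n1 K n + phi) mu].
  move=> phi_int def_mu.
  exists (bracket3 (Pmx c e) (Qmx a b 0 f) (- (a *: N))); split.
  - by apply/V_repsP; exists a, b, c, 0, e, f.
  - by split; [exact: V_cocycle | exact: phi_int].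
  by rewrite F_n1E bracket3D !add0r def_mu; exact: iso_refl.
have P0 : Pmx 0 (fun=> 0) = 0.
  by rewrite /Pmx scale0r add0r big1 // => k _; rewrite scale0r.
have T0 : Tmx (fun=> 0) = 0 by rewrite /Tmx big1 // => k _; rewrite scale0r.
case=> [[theta [alpha def_mu]] | [a def_mu] | def_mu].
- have Q0 : Qmx 0 theta 0 alpha = theta *: E_ 1 n + Tmx alpha.
    by rewrite /Qmx !scale0r addr0 add0r.
  apply: (realize 0 theta 0 (fun=> 0) alpha); rewrite P0 scale0r oppr0.
    by apply: integrable_bracket3_Q => u; rewrite crd_Qmx // mul0r.
  by rewrite Q0 addr0 -alg_F1E.
- have Q0 : Qmx 0 0 0 (fun=> 0) = 0 by rewrite /Qmx !scale0r T0 !addr0.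
  apply: (realize 0 0 (a 1%N) a (fun=> 0)); rewrite Q0 scale0r oppr0.
    by apply: integrable_bracket3_P => u; exact: crd1_Pmx.
  by rewrite -alg_lambdaE.
have Q0 : Qmx 1 0 0 (fun=> 0) = D by rewrite /Qmx !scale0r T0 !addr0 scale1r.
apply: (realize 1 0 0 (fun=> 0) (fun=> 0)); rewrite P0 Q0 scale1r.
  exact: integrable_xi1.
by rewrite addr0 -alg_RE.
Qed.

Lemma F_n1_leibniz : leibniz (F_n1 K n).
Proof.
move=> x y z; rewrite F_n1E !bracket3E !mulmx0 !scaler0 !addr0 !crdZ.
by rewrite crd_shift_low // mulr0 scale0r -!scalemxAl !scalerA mulrC subrr.
Qed.

End Deformations.

Theorem proposition3p6 (R : realType) (n : nat) (hn : (3 <= n)%N) :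
  [/\ leibniz (F_n1 R[i] n),
      forall phi : bilin 'rV[R[i]]_n,
        phi \in V_reps R[i] n -> cocycle2 (F_n1 R[i] n) phi,
      forall phi : bilin 'rV[R[i]]_n,
        phi \in V_reps R[i] n -> linear_integrable (F_n1 R[i] n) phi ->
        leibniz (F_n1 R[i] n + phi) /\
        exists2 mu : bilin 'rV[R[i]]_n,
          listed mu & isomorphic (F_n1 R[i] n + phi) mu
    & forall mu : bilin 'rV[R[i]]_n, listed mu ->
        exists phi : bilin 'rV[R[i]]_n,
          [/\ phi \in V_reps R[i] n,
              linear_integrable (F_n1 R[i] n) phi
            & isomorphic (F_n1 R[i] n + phi) mu]].
Proof.
split.
- exact: F_n1_leibniz.
- by move=> phi /(V_repsP hn)[a [b [c [d [e [f ->]]]]]]; exact: V_cocycle.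
- move=> phi phiV phi_int; split.
    by apply: leibnizD phi_int; exact: F_n1_leibniz.
  by apply: deformations_listed => //; exact: Num.Theory.pchar_num.
by move=> mu; exact: listed_deformations.
Qed.
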